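(* Let $n\ge 4$ and let $$A_n=\{\overline{v}_1,\dots,\overline{v}_n,\ \overline{u}_1,\dots,\overline{u}_{n-4},\overline{u}_{n-2},\ \overline{x}_1,\dots,\overline{x}_{n-4},\overline{x}_{n-2}\}.$$ Then $IOF_n^{par}=\langle A_n\rangle$.
   Context: Let $\overline{n}=\{1,\dots,n\}$. $I_n$ is the symmetric inverse semigroup (a monoid under composition) of all partial injections of $\overline{n}$ (including the empty map), maps written on the right and composed left to right. The fence on $\overline{n}$ is $1\prec 2\succ 3\prec 4\succ\cdots$, i.e. $x\prec y$ iff $x$ is odd, $y$ is even and $|x-y|=1$. A map $\alpha\in I_n$ is fence-preserving if $x\prec y$ implies $x\alpha\prec y\alpha$ for all $x,y\in dom(\alpha)$; $PFI_n$ is the monoid of all fence-preserving $\alpha\in I_n$. $IOF_n^{par}$ is the set of all $\alpha\in PFI_n$ that are regular in $PFI_n$ (equivalently, $\alpha^{-1}\in PFI_n$), order-preserving ($x<y$ implies $x\alpha\le y\alpha$ for all $x,y\in dom(\alpha)$) and parity-preserving ($x$ and $x\alpha$ have the same parity for all $x\in dom(\alpha)$). It is an inverse submonoid of $I_n$. For $i\in\{1,\dots,n\}$, $\overline{v}_i$ is the partial identity with domain $\overline{n}\setminus\{i\}$. For $i\in\{1,\dots,n-2\}$, $\overline{u}_i$ is the partial injection with domain $\{1,\dots,i\}\cup\{i+4,\dots,n\}$ (second set empty if $i+4>n$), with $\rho\,\overline{u}_i=\rho+2$ for $\rho\le i$ and $\rho\,\overline{u}_i=\rho$ for $\rho\ge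 i+4$; and $\overline{x}_i=(\overline{u}_i)^{-1}$. For $n=4$ the lists $\overline{u}_1,\dots,\overline{u}_{n-4}$ and $\overline{x}_1,\dots,\overline{x}_{n-4}$ are empty. For a non-empty subset $A$ of a semigroup $S$, $\langle A\rangle$ denotes the subsemigroup generated by $A$, i.e. the smallest subsemigroup of $S$ containing $A$.
   Formalization: The identity map lies in IOF_n^par but is not a non-empty product of elements of A_n, since each generator omits a point of its domain; the formal theorem therefore states that IOF_n^par is the union of the identity and the subsemigroup generated by A_n. *)

(* Defs.v *)
From HB Require Import structures.
From mathcomp Require Import all_boot fingroup.

Set Implicit Arguments.
Unset Strict Implicit.
Unset Printing Implicit Defensive.

Local Open Scope group_scope.

(* The chain {1, ..., n} is carried by 'I_n, the ordinal x standing for the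
   integer x.+1; parity and the fence order are read on these labels. *)
Definition label n (x : 'I_n) : nat := x.+1.

Definition partial_injective n (f : {ffun 'I_n -> option 'I_n}) : bool :=
  [forall x, forall y, (f x != None) && (f x == f y) ==> (x == y)].

(* The symmetric inverse semigroup; a x = None means that x lies outside the
   domain of a. *)
Record pinj n := PInj {
  pinj_val :> {ffun 'I_n -> option 'I_n};
  pinj_inj : partial_injective pinj_val }.

HB.instance Definition _ n := [isSub for @pinj_val n].
HB.instance Definition _ n := [Finite of pinj n by <:].

Section Pinj.
Variable n : nat.
Implicit Types a b c : pinj n.

Lemma partial_injectiveP (f : {ffun 'I_n -> option 'I_n}) :
  reflect (forall x y z, f x = Some z -> f y = Some z -> x = y)
          (partial_injective f).
Proof.
apply: (iffP forallP) => [fI x y z fx fy | fI x].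
  by move/forallP/(_ y): (fI x); rewrite fx fy eqxx /= => /eqP.
apply/forallP=> y; apply/implyP; case fx: (f x) => [z|] //= /eqP fy.
by apply/eqP; apply: fI fx (esym fy).
Qed.

Lemma pinjP a x y z : a x = Some z -> a y = Some z -> x = y.
Proof. exact: (partial_injectiveP a (pinj_inj a)). Qed.

Fact pinj_one_subproof :
  partial_injective [ffun x : 'I_n => Some x].
Proof. by apply/partial_injectiveP=> x y z; rewrite !ffunE => -[->] []. Qed.

Definition pinj_one : pinj n := PInj pinj_one_subproof.

Fact pinj_mul_subproof a b :
  partial_injective [ffun x => obind b (a x)].
Proof.
apply/partial_injectiveP=> x y z; rewrite !ffunE.
case ax: (a x) => [s|] //= bs; case ay: (a y) => [t|] //= bt.
by apply: pinjP ax _; rewrite (pinjP bs bt).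
Qed.

(* Maps act on the right: a * b is a followed by b. *)
Definition pinj_mul a b : pinj n := PInj (pinj_mul_subproof a b).

Fact pinj_inv_subproof a :
  partial_injective [ffun x => [pick y | a y == Some x]].
Proof.
apply/partial_injectiveP=> x y z; rewrite !ffunE.
case: pickP => // s /eqP as_ [<-]; case: pickP => // t /eqP at_ [ts].
by move: at_; rewrite ts as_ => -[].
Qed.

Definition pinj_inv a : pinj n := PInj (pinj_inv_subproof a).

Lemma pinj_ext a b : (forall x, a x = b x) -> a = b.
Proof. by move=> ab; apply/val_inj/ffunP. Qed.

Lemma pinj_invE a x y : (pinj_inv a x == Some y) = (a y == Some x).
Proof.
rewrite ffunE; case: pickP => [z /eqP az | /(_ y) -> //].
apply/eqP/eqP => [[<-] // | ay].
by rewrite (pinjP az ay).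
Qed.

Lemma option_ext (T : eqType) (u v : option T) :
  (forall y, (u == Some y) = (v == Some y)) -> u = v.
Proof.
case: u v => [x|] [y|] uv //.
- by apply/esym/eqP; rewrite -uv.
- by move: (uv x); rewrite eqxx.
- by move: (uv y); rewrite eqxx.
Qed.

Lemma pinj_mulA : associative pinj_mul.
Proof.
move=> a b c; apply: pinj_ext => x; rewrite !ffunE.
by case: (a x) => //= y; rewrite ffunE.
Qed.

Lemma pinj_mul1 : left_id pinj_one pinj_mul.
Proof. by move=> a; apply: pinj_ext => x; rewrite !ffunE. Qed.

Lemma pinj_1mul : right_id pinj_one pinj_mul.
Proof.
move=> a; apply: pinj_ext => x; rewrite !ffunE.
by case: (a x) => //= y; rewrite ffunE.
Qed.

Lemma pinj_invK : involutive pinj_inv.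
Proof.
by move=> a; apply: pinj_ext => x; apply: option_ext => y; rewrite !pinj_invE.
Qed.

Lemma pinj_mulE a b x y :
  (pinj_mul a b x == Some y) = [exists z, (a x == Some z) && (b z == Some y)].
Proof.
rewrite ffunE; apply/eqP/existsP => [|[z /andP[/eqP-> /eqP]] //].
by case: (a x) => //= z bz; exists z; rewrite bz !eqxx.
Qed.

Lemma pinj_invM : {morph pinj_inv : a b / pinj_mul a b >-> pinj_mul b a}.
Proof.
move=> a b; apply: pinj_ext => x; apply: option_ext => y.
rewrite pinj_invE !pinj_mulE; apply: eq_existsb => z.
by rewrite !pinj_invE andbC.
Qed.

End Pinj.

HB.instance Definition _ n := isStarMonoid.Build (pinj n)
  (@pinj_mulA n) (@pinj_mul1 n) (@pinj_invK n) (@pinj_invM n).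

Definition fence_lt n (x y : 'I_n) : bool :=
  [&& odd (label x), ~~ odd (label y) &
      (label x == (label y).+1) || (label y == (label x).+1)].

Definition fence_preserving n (a : pinj n) : bool :=
  [forall x, forall y, forall x', forall y',
     [&& a x == Some x', a y == Some y' & fence_lt x y] ==> fence_lt x' y'].

Definition order_preserving n (a : pinj n) : bool :=
  [forall x : 'I_n, forall y : 'I_n, forall x' : 'I_n, forall y' : 'I_n,
     [&& a x == Some x', a y == Some y' & x < y] ==> (x' <= y')].

Definition parity_preserving n (a : pinj n) : bool :=
  [forall x, forall x', (a x == Some x') ==> (odd (label x) == odd (label x'))].

Definition PFI n : {set pinj n} := [set a | fence_preserving a].

Definition regular_in (S : finStarMonoidType) (M : {set S}) (a : S) : bool :=
  (a \in M) && [exists b in M, a * b * a == a].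

Definition IOFpar n : {set pinj n} :=
  [set a | [&& regular_in (PFI n) a, order_preserving a & parity_preserving a]].

Definition subsemigroup (S : finStarMonoidType) (M : {set S}) : bool :=
  [forall a in M, forall b in M, a * b \in M].

(* This is the subsemigroup generated by A: the identity is not thrown in. *)
Definition sgen (S : finStarMonoidType) (A : {set S}) : {set S} :=
  \bigcap_(M : {set S} | (A \subset M) && subsemigroup M) M.

Section Generators.
Variable n : nat.

Fact vbar_subproof (i : 'I_n) :
  partial_injective [ffun x => if x == i then None else Some x].
Proof.
apply/partial_injectiveP=> x y z; rewrite !ffunE.
by case: ifP => // _ [->]; case: ifP => // _ [->].
Qed.

Definition vbar (i : 'I_n) : pinj n := PInj (vbar_subproof i).

(* x.+2 has label (label x).+2, and insub tests that it is a point of 'I_n,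
   which is automatic for i <= n - 2. *)
Definition ubar_fun (i : nat) : {ffun 'I_n -> option 'I_n} :=
  [ffun x : 'I_n =>
     if label x <= i then insub x.+2
     else if i + 4 <= label x then Some x
     else None].

Fact ubar_subproof i : partial_injective (ubar_fun i).
Proof.
have E (x z : 'I_n) : ubar_fun i x = Some z ->
    (label x <= i /\ z = x.+2 :> nat) \/ (i + 4 <= label x /\ z = x).
  rewrite ffunE; case: ifP => [xi | _].
    by case: insubP => // s _ sx [<-]; left.
  by case: ifP => // xi [<-]; right.
have no (x y z : 'I_n) : label x <= i -> z = x.+2 :> nat ->
    i + 4 <= label y -> z = y -> x = y.
  rewrite /label => xi zx iy zy; move: iy; rewrite -zy zx addnC !ltnS => ix.
  by have:= leq_ltn_trans (leq_trans xi (leqW ix)) (ltnSn _); rewrite ?ltnn.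
apply/partial_injectiveP=> x y z /E[[xi zx]|[ix zx]] /E[[yi zy]|[iy zy]].
- by apply/val_inj; move: zy; rewrite zx => -[].
- exact: no xi zx iy zy.
- by apply/esym; exact: no yi zy ix zx.
- by rewrite -zx.
Qed.

Definition ubar (i : nat) : pinj n := PInj (ubar_subproof i).

Definition xbar (i : nat) : pinj n := (ubar i)^-1.

(* The index set {1, ..., n - 4} together with n - 2. *)
Definition ux_index (i : nat) : bool := (0 < i <= n - 4)%N || (i == n - 2)%N.

Definition A_ : {set pinj n} :=
  [set vbar i | i : 'I_n]
  :|: [set ubar i | i : 'I_n & ux_index i]
  :|: [set xbar i | i : 'I_n & ux_index i].

(* No product of elements of A_ is a permutation, so the identity of the monoid
   IOFpar n is obtained only as the empty product. *)
Lemma one_notin_sgen_A : 1 \notin sgen A_.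
Proof.
pose D : {set pinj n} := [set a | [exists x, pinj_val a x == None]].
have sD : (A_ \subset D) && subsemigroup D.
  apply/andP; split.
    apply/subsetP=> a /setUP[/setUP[]|] /imsetP[i _ ->]; rewrite inE;
      apply/existsP.
    - by exists i; rewrite ffunE eqxx.
    - exists i; rewrite ffunE /label ltnn leqNgt.
      by rewrite addnS ltnS -[X in X < _]addn0 ltn_add2l.
    - have n0 : 0 < n by apply: leq_ltn_trans (ltn_ord i).
      exists (Ordinal n0); rewrite ffunE; case: pickP => // y.
      rewrite ffunE; case: ifP => [_|_].
        by case: insubP => // s _ sy /eqP[ss]; move: sy; rewrite ss.
      case: ifP => // iy /eqP[yy]; move: iy.
      by rewrite yy /label /= addnS ltnS addnS ltn0.
  apply/forall_inP=> a; rewrite inE => /existsP[x /eqP ax].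
  apply/forall_inP=> b _; rewrite inE; apply/existsP; exists x.
  by rewrite ffunE ax.
apply/negP=> /bigcapP/(_ D sD); rewrite inE => /existsP[x].
by rewrite ffunE.
Qed.

End Generators.

(* Main.v *)
(** Elements of [IOFpar n] are the partial injections that preserve order,
    parity and, in both directions, adjacency. Let [T] be the largest point
    occurring in a pair [x |-> y] of [a] with [x != y]; up to inversion
    [a x = T] with [x < T]. All pairs above are fixed, so parity and adjacency
    force the three points after [x] out of the domain of [a], whence
    [a = u * (u^-1 * a)], where [u] shifts the points up to [x] by 2. In
    [u^-1 * a] the preimage of [T] is [x + 2], and no point beyond [T] is moved;
    iterating, [T] becomes fixed and one goes on with a smaller [T], until a
    partial identity is reached. *)
Require Import Defs.
From mathcomp Require Import all_boot fingroup zify.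

Set Implicit Arguments.
Unset Strict Implicit.
Unset Printing Implicit Defensive.

Local Open Scope group_scope.

(** * Generated subsemigroups and submonoids *)

Section GeneratedSubsemigroup.
Variables (S : finStarMonoidType) (A : {set S}).

Lemma sub_sgen : A \subset sgen A.
Proof. by apply/bigcapsP=> M /andP[]. Qed.

Lemma sgen_min (M : {set S}) :
  A \subset M -> subsemigroup M -> sgen A \subset M.
Proof. by move=> AM MM; apply: bigcap_inf; rewrite AM. Qed.

Lemma sgenM a b : a \in sgen A -> b \in sgen A -> a * b \in sgen A.
Proof.
move=> /bigcapP aA /bigcapP bA; apply/bigcapP=> M MP.
case/andP: (MP) => _ /forall_inP/(_ _ (aA _ MP))/forall_inP; apply.
exact: bA.
Qed.

Lemma sgenV a :
  {in A, forall b, b^-1 \in A} -> a \in sgen A -> a^-1 \in sgen A.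
Proof.
move=> AV; pose M : {set S} := [set b | b^-1 \in sgen A].
suff /subsetP sM: sgen A \subset M by move/sM; rewrite inE.
apply: sgen_min.
  by apply/subsetP=> b bA; rewrite inE (subsetP sub_sgen) ?AV.
apply/forall_inP=> b; rewrite inE => bM; apply/forall_inP=> c.
by rewrite !inE => cM; rewrite invgM sgenM.
Qed.

(** The identity is adjoined because, for [A_ n], no product of generators is the identity
    ([one_notin_sgen_A]). *)
Definition mgen : {set S} := 1 |: sgen A.

Lemma mem_mgen a : a \in A -> a \in mgen.
Proof. by move/(subsetP sub_sgen); rewrite inE orbC => ->. Qed.

Lemma mgen1 : 1 \in mgen. Proof. by rewrite !inE eqxx. Qed.

Lemma mgenM a b : a \in mgen -> b \in mgen -> a * b \in mgen.
Proof.
move=> /setU1P[-> | aA] /setU1P[-> | bA]; rewrite ?mul1g ?mulg1 ?mgen1 //.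
- by apply/setU1P; right.
- by apply/setU1P; right.
- by apply/setU1P; right; apply: sgenM.
Qed.

Lemma mgenV a :
  {in A, forall b, b^-1 \in A} -> a \in mgen -> a^-1 \in mgen.
Proof.
move=> AV /setU1P[-> | aA]; first by rewrite invg1 mgen1.
by apply/setU1P; right; apply: sgenV.
Qed.

End GeneratedSubsemigroup.

(** * Pointwise description of [IOFpar n] *)

Section PartialInjections.
Variable n : nat.
Implicit Types (a b c : pinj n) (x y : 'I_n).

Lemma pinj1E x : (1 : pinj n) x = Some x.
Proof. by rewrite ffunE. Qed.

Lemma pinjMP a b x y :
  (a * b) x = Some y <-> exists2 z, a x = Some z & b z = Some y.
Proof.
rewrite ffunE; split=> [|[z -> //]].
by case: (a x) => //= z bz; exists z.
Qed.

Lemma pinjVP a x y : (a^-1) x = Some y <-> a y = Some x.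
Proof. by split=> /eqP h; apply/eqP; move: h; rewrite pinj_invE. Qed.

Lemma pinj_eqP a b : (forall x y, a x = Some y <-> b x = Some y) -> a = b.
Proof.
move=> ab; apply: pinj_ext => x; apply: option_ext => y.
by apply/eqP/eqP => /ab.
Qed.

(** [b * b^-1] is the partial identity on the domain of [b], which contains that of [a]. *)
Lemma mulVgK_dom a b :
  (forall x y, a x = Some y -> exists z, b x = Some z) -> a = b * (b^-1 * a).
Proof.
move=> dom_ab; apply: pinj_eqP => x y; split.
  move=> ax; have [z bx] := dom_ab _ _ ax.
  by apply/pinjMP; exists z => //; apply/pinjMP; exists x => //; apply/pinjVP.
case/pinjMP=> z bx /pinjMP[t /pinjVP bt at_].
by rewrite (pinjP bx bt).
Qed.

Definition order_parity_adj a :=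
  forall x y x' y', a x = Some x' -> a y = Some y' ->
  [/\ odd x = odd x', (x < y)%N -> (x' < y')%N
    & (y = x.+1 :> nat) <-> (y' = x'.+1 :> nat)].

Lemma order_parity_adj1 : order_parity_adj 1.
Proof. by move=> x y x' y'; rewrite !pinj1E => -[<-] [<-]; split. Qed.

Lemma order_parity_adjM a b :
  order_parity_adj a -> order_parity_adj b -> order_parity_adj (a * b).
Proof.
move=> aP bP x y x' y' /pinjMP[s as_ bs] /pinjMP[t at_ bt].
have [p1 o1 c1] := aP _ _ _ _ as_ at_; have [p2 o2 c2] := bP _ _ _ _ bs bt.
split; first by rewrite p1.
- by move/o1/o2.
- by rewrite c1.
Qed.

Lemma order_parity_adjV a : order_parity_adj a -> order_parity_adj a^-1.
Proof.
move=> aP x y x' y' /pinjVP ax /pinjVP ay.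
have [p o c] := aP _ _ _ _ ax ay; have [_ o' _] := aP _ _ _ _ ay ax.
split; [by [] | move=> xy | by rewrite c].
case: (ltngtP x' y') => // [/o'|/val_inj e]; first by lia.
by move: ax xy; rewrite e ay => -[->]; rewrite ltnn.
Qed.

Lemma fence_ltE x y :
  fence_lt x y =
    [&& ~~ odd x, odd y & (x == y.+1 :> nat) || (y == x.+1 :> nat)].
Proof. by rewrite /fence_lt /label /= negbK !eqSS. Qed.

Lemma order_parity_adj_PFI a : order_parity_adj a -> a \in PFI n.
Proof.
move=> aP; rewrite inE.
apply/forallP=> x; apply/forallP=> y; apply/forallP=> x'; apply/forallP=> y'.
apply/implyP=> /and3P[/eqP ax /eqP ay]; rewrite !fence_ltE.
have [px _ cx] := aP _ _ _ _ ax ay; have [py _ cy] := aP _ _ _ _ ay ax.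
rewrite px py => /and3P[-> -> /orP[] /eqP xy] /=.
  by rewrite (cy.1 xy) eqxx.
by rewrite (cx.1 xy) eqxx orbT.
Qed.

Lemma PFI_adj a x y x' y' :
    a \in PFI n -> a x = Some x' -> a y = Some y' -> y = x.+1 :> nat ->
  x' = y'.+1 :> nat \/ y' = x'.+1 :> nat.
Proof.
rewrite inE => aF ax ay yx.
have F s t s' t' : a s = Some s' -> a t = Some t' -> fence_lt s t ->
    fence_lt s' t'.
  move=> as_ at_ st; move/forallP/(_ s)/forallP/(_ t): aF.
  by move=> /forallP/(_ s')/forallP/(_ t'); rewrite as_ at_ st !eqxx.
have [ox|ox] := boolP (odd x).
  have /(F _ _ _ _ ay ax) : fence_lt y x by rewrite fence_ltE yx /= ox eqxx.
  by rewrite fence_ltE => /and3P[_ _ /orP[]/eqP]; [right | left].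
have /(F _ _ _ _ ax ay) : fence_lt x y.
  by rewrite fence_ltE yx /= ox eqxx orbT.
by rewrite fence_ltE => /and3P[_ _ /orP[]/eqP]; [left | right].
Qed.

Lemma IOFparP a : reflect (order_parity_adj a) (a \in IOFpar n).
Proof.
rewrite inE.
apply: (iffP and3P) => [[/andP[aF /exists_inP[b bF /eqP aba]] aO aP] | aP].
  (* The regularity witness [b] need not be [a^-1], but it inverts [a] on the image of [a], which is
     enough to reflect adjacency. *)
  have ba x x' : a x = Some x' -> b x' = Some x.
    move=> ax; have: (a * b * a) x = Some x' by rewrite aba.
    case/pinjMP=> w /pinjMP[z]; rewrite ax => -[<-] bw aw.
    by rewrite bw (pinjP ax aw).
  have O x y x' y' : a x = Some x' -> a y = Some y' -> (x < y)%N ->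
      (x' < y')%N.
    move=> ax ay xy; rewrite ltn_neqAle; apply/andP; split.
      apply: contraTneq xy => /val_inj e; rewrite -e in ay.
      by rewrite (pinjP ax ay) ltnn.
    move/forallP/(_ x)/forallP/(_ y): aO.
    by move=> /forallP/(_ x')/forallP/(_ y'); rewrite ax ay xy !eqxx.
  move=> x y x' y' ax ay; split; last split.
  - move/forallP/(_ x)/forallP/(_ x'): aP; rewrite ax eqxx /= => /eqP.
    by case: (odd x); case: (odd x').
  - exact: O ax ay.
  (* The fence gives adjacency up to orientation; order selects the orientation. *)
  - by move=> yx; have := PFI_adj aF ax ay yx; have := O _ _ _ _ ax ay; lia.
  - move=> yx; have := PFI_adj bF (ba _ _ ax) (ba _ _ ay) yx.
    by have := O _ _ _ _ ay ax; lia.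
split.
- rewrite /regular_in order_parity_adj_PFI //=; apply/exists_inP; exists a^-1.
    exact/order_parity_adj_PFI/order_parity_adjV.
  by rewrite -mulgA -mulVgK_dom // => x y ax; exists y.
- apply/forallP=> x; apply/forallP=> y; apply/forallP=> x'; apply/forallP=> y'.
  apply/implyP=> /and3P[/eqP ax /eqP ay xy].
  by have [_ /(_ xy)/ltnW] := aP _ _ _ _ ax ay.
apply/forallP=> x; apply/forallP=> x'; apply/implyP=> /eqP ax.
by have [e _ _] := aP _ _ _ _ ax ax; rewrite /label /= e.
Qed.

(** * The generators and the partial identities *)

Lemma vbarP (i : 'I_n) x y : vbar i x = Some y <-> x != i /\ y = x.
Proof.
rewrite ffunE; case: eqP => [->|_]; first by split=> // -[].
by split=> [[->]|[_ ->]].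
Qed.

Lemma vbarV (i : 'I_n) : (vbar i)^-1 = vbar i.
Proof.
apply: pinj_eqP => x y; split=> [/pinjVP|] /vbarP[xi e].
  by apply/vbarP; rewrite e.
by apply/pinjVP/vbarP; rewrite e.
Qed.

Lemma ubarP i x y :
  ubar n i x = Some y <->
    (x < i /\ y = x.+2 :> nat \/ i + 3 <= x /\ y = x :> nat)%N.
Proof.
rewrite ffunE /label; case: ifP => xi.
  case: insubP => [s _ sx | nx]; split=> //.
  - by move=> [<-]; left.
  - move=> [[_ yx]|]; last by lia.
    by congr Some; apply: val_inj; rewrite /= sx.
  - by have := ltn_ord y; lia.
case: ifP => ix; split=> //; last by lia.
  by move=> [<-]; right; lia.
by move=> [|[_ yx]]; [lia | congr Some; apply: val_inj].
Qed.

Lemma order_parity_adj_vbar (i : 'I_n) : order_parity_adj (vbar i).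
Proof. by move=> x y x' y' /vbarP[_ ->] /vbarP[_ ->]. Qed.

(** The points on either side of the omitted block, [i - 1] and [i + 3], go to [i + 1] and [i + 3],
    still at distance 2, so no adjacency is created. *)
Lemma order_parity_adj_ubar i : order_parity_adj (ubar n i).
Proof. by move=> x y x' y' /ubarP ux /ubarP uy; split; lia. Qed.

Lemma A_V : {in A_ n, forall a, a^-1 \in A_ n}.
Proof.
move=> a /setUP[/setUP[]|] /imsetP[i iP ->].
- by rewrite vbarV !inE imset_f.
- by apply/setUP; right; apply: imset_f.
- by rewrite invgK; apply/setUP; left; apply/setUP; right; apply: imset_f.
Qed.

Lemma vbar_mgen (i : 'I_n) : vbar i \in mgen (A_ n).
Proof. by apply: mem_mgen; rewrite !inE imset_f. Qed.

Lemma ubar_mgen i : (0 < i <= n - 2)%N -> ubar n i \in mgen (A_ n).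
Proof.
move=> /andP[i0 iltn].
have gen j (jn : (j < n)%N) : ux_index n j -> ubar n j \in mgen (A_ n).
  move=> jP; apply: mem_mgen; apply/setUP; left; apply/setUP; right.
  by apply/imsetP; exists (Ordinal jn); rewrite ?inE.
have [i3 | ni3] := eqVneq i (n - 3)%N; last first.
  by apply: gen; rewrite ?/ux_index; lia.
(* [ubar n (n - 3)] is not a generator: it is the restriction of
   [ubar n (n - 2)] that omits the label [n - 2]. *)
have n3 : (n - 3 < n)%N by lia.
suff ->: ubar n i = vbar (Ordinal n3) * ubar n (n - 2).
  by apply: mgenM (vbar_mgen _) (gen _ _ _); rewrite ?/ux_index; lia.
apply: pinj_eqP => x y; have xn := ltn_ord x; split.
  move/ubarP=> ux; apply/pinjMP; exists x.
    by apply/vbarP; split=> //; rewrite -val_eqE /=; lia.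
  by apply/ubarP; lia.
case/pinjMP=> z /vbarP[]; rewrite -val_eqE /= => xi -> /ubarP ux.
by apply/ubarP; lia.
Qed.

Lemma partial_id_mgen a :
  (forall x y, a x = Some y -> x = y) -> a \in mgen (A_ n).
Proof.
(* [b] is the product of the [vbar i] over the points [i] outside the domain of [a]. *)
move=> aI; suff [b bA bE]: exists2 b, b \in mgen (A_ n) &
    forall x, b x = if x \in [seq x <- enum 'I_n | a x == None]
                    then None else Some x.
  suff -> : a = b by [].
  apply: pinj_ext => x; rewrite bE mem_filter mem_enum andbT.
  by case ax: (a x) => [y|] //=; rewrite (aI _ _ ax).
elim: [seq _ <- _ | _] => [|i s [b bA bE]].
  by exists 1 => [|x]; rewrite ?mgen1 // pinj1E.
exists (vbar i * b) => [|x]; first by rewrite mgenM ?vbar_mgen.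
by rewrite !ffunE in_cons; case: eqP => //= _; rewrite bE.
Qed.

(** * Descent on the largest moved point *)

Definition fixed_from T a :=
  forall x y, a x = Some y -> (T <= x)%N || (T <= y)%N -> x = y.

Lemma fixed_fromV T a : fixed_from T a -> fixed_from T a^-1.
Proof.
by move=> aT x y /pinjVP ay xy; apply/esym/(aT _ _ ay); rewrite orbC.
Qed.

Lemma last_moved_dom a x (T : 'I_n) :
    order_parity_adj a -> fixed_from T.+1 a -> a x = Some T -> (x < T)%N ->
  forall y z, a y = Some z -> (y <= x)%N || (x + 4 <= y)%N.
Proof.
move=> aP aT ax xT y z ay; have [|xy] := leqP y x; first by [].
have [p1 o1 c1] := aP _ _ _ _ ax ay.
have zT := o1 xy.
have yz : y = z by apply: (aT _ _ ay); rewrite zT orbT.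
(* Parity gives [x + 2 <= T < y]. If [y = x + 3], then [T = x + 2], and the images [T] and [y] would
   be adjacent while [x] and [y] are not. *)
by move: p1 c1; rewrite yz; have [p2 _ _] := aP _ _ _ _ ax ax; lia.
Qed.

Lemma fixed_from_step a x (T : 'I_n) :
    order_parity_adj a -> fixed_from T.+1 a -> a x = Some T -> (x < T)%N ->
  let a' := (ubar n x.+1)^-1 * a in
  [/\ a = ubar n x.+1 * a', (x.+2 <= T)%N, fixed_from T.+1 a'
    & forall s : 'I_n, s = x.+2 :> nat -> a' s = Some T].
Proof.
move=> aP aT ax xT a'.
have dom_a := last_moved_dom aP aT ax xT.
have [p _ _] := aP _ _ _ _ ax ax.
have x2T : (x.+2 <= T)%N by lia.
split=> //.
(* In labels, [ubar n x.+1] is defined up to [x + 1] and from [x + 5] on, that is, at the points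
   [<= x] and [>= x + 4]. *)
- apply: mulVgK_dom => y z /dom_a yx; have Tn := ltn_ord T.
  have [yx'|xy] := leqP y x; last first.
    by exists y; apply/ubarP; lia.
  have y2n : (y.+2 < n)%N by lia.
  by exists (Ordinal y2n); apply/ubarP; left.
- move=> s t /pinjMP[y /pinjVP /ubarP uy ay] st.
  case: uy => [[yx sy]|[xy sy]]; last first.
    by rewrite (val_inj sy); apply: (aT _ _ ay); rewrite -sy.
  (* Here [s = y + 2 <= x + 2 <= T], so only [t > T] remains; then [a] fixes [y = t], against
     [y <= x < T]. *)
  case: (leqP t T) => Tt; first by lia.
  by have := aT _ _ ay; rewrite Tt orbT => /(_ isT) yt; rewrite yt in yx; lia.
- move=> s sx; apply/pinjMP; exists x => //; apply/pinjVP/ubarP.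
  by left.
Qed.

Section Step.
Variable T : 'I_n.
Hypothesis IH :
  forall a, order_parity_adj a -> fixed_from T a -> a \in mgen (A_ n).

(** By injectivity, once [T] is fixed no other pair of [a] involves it. *)
Lemma fixed_from_fix a : a T = Some T -> fixed_from T.+1 a -> fixed_from T a.
Proof.
move=> aTT aT x y ax /orP[]; rewrite leq_eqVlt => /orP[|xT].
- by move=> /eqP/val_inj e; move: ax; rewrite -e aTT => -[].
- by apply: (aT _ _ ax); rewrite xT.
- by move=> /eqP/val_inj e; rewrite -e in ax *; apply: pinjP ax aTT.
- by apply: (aT _ _ ax); rewrite xT orbT.
Qed.

Lemma mgen_last_raised a x :
  order_parity_adj a -> fixed_from T.+1 a -> a x = Some T -> (x < T)%N ->
  a \in mgen (A_ n).
Proof.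
(* Induction on the distance from [x] to [T], which each step lowers by 2. *)
have [d] := ubnP (T - x)%N; elim: d a x => // d IHd a x dx aP aT ax xT.
have [a_eq x2T a'T a'x] := fixed_from_step aP aT ax xT.
have Tn := ltn_ord T.
rewrite a_eq; apply: mgenM; first by apply: ubar_mgen; lia.
have x2n : (x.+2 < n)%N by lia.
have {}a'x := a'x (Ordinal x2n) erefl.
have a'P : order_parity_adj ((ubar n x.+1)^-1 * a).
  apply: order_parity_adjM aP.
  exact/order_parity_adjV/order_parity_adj_ubar.
have [x2|nx2] := eqVneq x.+2 (T : nat).
  have e : Ordinal x2n = T by apply: val_inj.
  by rewrite e in a'x; apply: IH a'P (fixed_from_fix a'x a'T).
by apply: IHd a'P a'T a'x _; rewrite /=; lia.
Qed.

Lemma mgen_fixed_fromS a :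
  order_parity_adj a -> fixed_from T.+1 a -> a \in mgen (A_ n).
Proof.
have raised b x : order_parity_adj b -> fixed_from T.+1 b -> b x = Some T ->
    b \in mgen (A_ n).
  move=> bP bT bx; case: (ltngtP x T) => [|Tx|/val_inj xT].
  - exact: mgen_last_raised bP bT bx.
  - by have := bT _ _ bx; rewrite Tx => /(_ isT) e; rewrite e ltnn in Tx.
  - by rewrite xT in bx; apply: IH bP (fixed_from_fix bx bT).
(* If [T] lies in the domain, inversion puts it in the image. If it lies in neither,
   [fixed_from T a] already holds. *)
move=> aP aT; case aTy: (a T) => [y|].
  rewrite -[a]invgK; apply: mgenV A_V _.
  apply: (raised _ y); [exact: order_parity_adjV | exact: fixed_fromV |].
  exact/pinjVP.
have [/existsP[x /eqP ax]|noT] := boolP [exists x, a x == Some T].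
  exact: raised aP aT ax.
apply: IH => // x y ax /orP[]; rewrite leq_eqVlt => /orP[/eqP/val_inj e|xT].
- by rewrite -e aTy in ax.
- by apply: (aT _ _ ax); rewrite xT.
- by case/existsP: noT; exists x; rewrite ax e.
- by apply: (aT _ _ ax); rewrite xT orbT.
Qed.

End Step.

Lemma mgen_fixed_from T a :
  order_parity_adj a -> fixed_from T a -> a \in mgen (A_ n).
Proof.
elim: T a => [|T IHT] a aP aT.
  by apply: partial_id_mgen => x y /aT; apply.
(* For [T >= n] no point reaches [T], so [fixed_from T] is vacuous. *)
have [Tn|nT] := ltnP T n; first exact: (@mgen_fixed_fromS (Ordinal Tn)).
apply: IHT => // x y _; have := ltn_ord x; have := ltn_ord y; lia.
Qed.

End PartialInjections.

Theorem corollary1 (n : nat) (n_ge4 : (4 <= n)%N) :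
  IOFpar n = (1%g |: sgen (A_ n)).
Proof.
apply/eqP; rewrite eqEsubset; apply/andP; split; apply/subsetP => a.
  (* The descent starts at [T = n], where [fixed_from] holds vacuously. *)
  move=> /IOFparP aP; apply: (@mgen_fixed_from n n) => // x y _.
  by have := ltn_ord x; have := ltn_ord y; lia.
case/setU1P=> [->|]; first exact/IOFparP/order_parity_adj1.
apply/subsetP: a; apply: sgen_min.
  apply/subsetP=> a /setUP[/setUP[]|] /imsetP[i _ ->]; apply/IOFparP.
  - exact: order_parity_adj_vbar.
  - exact: order_parity_adj_ubar.
  - exact/order_parity_adjV/order_parity_adj_ubar.
apply/forall_inP=> a /IOFparP aP; apply/forall_inP=> b /IOFparP bP.
exact/IOFparP/order_parity_adjM.
Qed.
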